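(* Let $\mathbb{U}=(U,\mathcal{B})$ and $\mathbb{U}'=(U',\mathcal{B}')$ be unitals of orders $q$ and $q'$, respectively. If $q>2$, then every graph isomorphism $\beta$ from the confluence graph of $\mathbb{U}$ to the confluence graph of $\mathbb{U}'$ extends to an isomorphism from $\mathbb{U}$ onto $\mathbb{U}'$; i.e., there is a bijection $\alpha\colon U\to U'$ such that $(\alpha,\beta)$ is an isomorphism of incidence structures ($x\in B$ iff $\alpha(x)\in\beta(B)$).
   Context: A unital of order $q>1$ (integer) is a $2$-$(q^3+1,q+1,1)$ design: a set of $q^3+1$ points with a family of blocks, each a $(q+1)$-subset, such that any two distinct points lie in exactly one common block. The confluence graph of a unital has the blocks as vertices, two distinct blocks being adjacent if they share a point. *)

(* Defs.v *)
From mathcomp Require Import all_boot.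
Set Implicit Arguments.
Unset Strict Implicit.
Unset Printing Implicit Defensive.

(* A 2-(q^3+1, q+1, 1) design whose point set is the whole type U. *)
Definition unital (q : nat) (U : finType) (B : {set {set U}}) : Prop :=
  [/\ 1 < q,
      #|U| = q ^ 3 + 1,
      forall b : {set U}, b \in B -> #|b| = q + 1
    & forall x y : U, x != y ->
        exists! b : {set U}, [/\ b \in B, x \in b & y \in b]].

Definition block (U : finType) (B : {set {set U}}) : finType :=
  {b : {set U} | b \in B}.

Definition confluence (U : finType) (B : {set {set U}}) : rel (block B) :=
  fun b c => (b != c) && [exists x : U, (x \in val b) && (x \in val c)].

Definition graph_iso (V V' : finType) (e : rel V) (e' : rel V')
    (f : V -> V') : Prop :=
  bijective f /\ forall x y : V, e x y <-> e' (f x) (f y).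

Definition incidence_iso (U U' : finType)
    (B : {set {set U}}) (B' : {set {set U'}})
    (alpha : U -> U') (beta : block B -> block B') : Prop :=
  [/\ bijective alpha, bijective beta
    & forall (x : U) (b : block B),
        x \in val b <-> alpha x \in val (beta b)].

(* Main.v *)
(** A clique of q^2 pairwise meeting blocks in a unital of order q > 2 always
    has a common point.  If it had none, every point would lie on at most q+1
    of its blocks, and either some point attains this bound, in which case the
    clique covers q^2+q+1 points, or all degrees are exactly q and it covers
    q^2+q points (the dual affine plane case).  With S the covered set, s its
    size and k_d the number of points of S on a block d outside the clique,
    the joins between S and its complement give
      sum_d (q+1-k_d)(k_d-1) = (q^3+1-s)(s-q^2),
    which exceeds the upper bound (q-1)/2 * sum_d k_d(k_d-1) as soon as q > 2.
    Hence a graph isomorphism maps pencils to pencils, and a pencil determines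
    its point. *)
Require Import Defs.
From mathcomp Require Import all_boot.
From mathcomp Require Import zify.
Set Implicit Arguments.
Unset Strict Implicit.
Unset Printing Implicit Defensive.

(** * Double counting of incidences *)

Definition pencil (U : finType) (F : {set {set U}}) (x : U) : {set {set U}} :=
  [set b in F | x \in b].

(** The weight [w d] allows second moments: [w d = #|d :&: A'|] counts pairs of points joined by a
    block. *)
Lemma weighted_double_count (U : finType) (F : {set {set U}}) (A : {set U})
    (w : {set U} -> nat) :
  \sum_(d in F) #|d :&: A| * w d = \sum_(x in A) \sum_(d in pencil F x) w d.
Proof.
under eq_bigr => d _ do rewrite -sum1_card big_distrl /=.
rewrite (exchange_big_dep (mem A)) /=; last by move=> d x _; rewrite inE => /andP[].
apply: eq_bigr => x xA; apply: eq_big => [d|d _]; last by rewrite mul1n.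
by rewrite !inE xA andbT.
Qed.

Lemma double_count (U : finType) (F : {set {set U}}) (A : {set U}) :
  \sum_(d in F) #|d :&: A| = \sum_(x in A) #|pencil F x|.
Proof.
under eq_bigr => d _ do rewrite -[#|_|]muln1.
by rewrite (weighted_double_count F A (fun=> 1)); under eq_bigr do rewrite sum1_card.
Qed.

Lemma sum_eq_const_bound (T : finType) (A : {set T}) (f : T -> nat) (k : nat) :
  (forall x, x \in A -> f x <= k) -> \sum_(x in A) f x = #|A| * k ->
  forall x, x \in A -> f x = k.
Proof.
move=> fk sf x xA; apply/eqP; rewrite eqn_leq fk //=.
have le_rest : \sum_(i in A | i != x) f i <= \sum_(i in A | i != x) k.
  by apply: leq_sum => i /andP[/fk].
move: sf; rewrite -sum_nat_const (bigD1 x) // [RHS](bigD1 x) //=; lia.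
Qed.

Lemma sum1_neq (T : finType) (A : {set T}) (x : T) :
  \sum_(y in A | y != x) 1 = #|A :\ x|.
Proof. by rewrite -sum1_card; apply: eq_bigl => y; rewrite !inE andbC. Qed.

(** * Parameters of a unital *)

Section Unital.

Variables (q : nat) (U : finType) (B : {set {set U}}).
Hypothesis hU : unital q B.

Let q_gt1 : 1 < q. Proof. by case: hU. Qed.
Let card_points : #|U| = q ^ 3 + 1. Proof. by case: hU. Qed.
Let card_block b : b \in B -> #|b| = q + 1. Proof. by case: hU => _ _ + _; apply. Qed.

Lemma card_pencil2 x y : x != y -> #|pencil (pencil B x) y| = 1.
Proof.
case: hU => _ _ _ /[apply] -[b [[bB xb yb] b_uniq]].
rewrite -(cards1 b); congr #|pred_of_set _|; apply/setP => c; rewrite !inE.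
apply/andP/eqP => [[/andP[cB xc] yc]|->]; last by rewrite bB xb yb.
by apply/esym/b_uniq.
Qed.

(** The blocks through [x] partition the other q^3 points into sets of size q. *)
Lemma card_pencil x : #|pencil B x| = q ^ 2.
Proof.
have := double_count (pencil B x) (~: [set x]).
rewrite [RHS](eq_bigr (fun=> 1)); last first.
  by move=> y; rewrite !inE eq_sym => /card_pencil2.
rewrite (eq_bigr (fun=> q)); last first.
  move=> b; rewrite inE => /andP[bB xb].
  have := cardsD1 x b; rewrite xb card_block // setDE; lia.
rewrite sum_nat_const sum1_card.
have := cardsC1 x; rewrite card_points => -> /eqP.
by rewrite addn1 /= expnSr eqn_pmul2r; [move/eqP|lia].
Qed.

(** Otherwise two distinct points would have q^2 > 1 common blocks. *)
Lemma pencil_inj : injective (pencil B).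
Proof.
move=> x y exy; apply/eqP; apply: contraT => /card_pencil2.
have -> : pencil (pencil B x) y = pencil B y.
  by apply/setP => b; rewrite exy !inE -andbA andbb.
by rewrite card_pencil; nia.
Qed.

(** Counting flags gives |B| (q+1) = (q^3+1) q^2, and q^3+1 = (q+1)(q^2-q+1). *)
Lemma card_blocks : #|B| = q ^ 2 * (q * (q - 1) + 1).
Proof.
have := double_count B [set: U].
rewrite (eq_bigr (fun=> q + 1)); last by move=> b bB; rewrite setIT card_block.
under [RHS]eq_bigr do rewrite card_pencil.
rewrite !sum_nat_const cardsT card_points => e.
have q1_gt0 : 0 < q + 1 by lia.
apply/eqP; rewrite -(eqn_pmul2r q1_gt0) e; apply/eqP.
have [p ->] : exists p, q = p + 1 by exists (q - 1); lia.
by rewrite addnK; nia.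
Qed.

Lemma card_block_meet b c : b \in B -> c \in B -> b != c -> #|b :&: c| <= 1.
Proof.
move=> bB cB nbc; rewrite leqNgt; apply/negP => /card_gt1P[x [y []]].
rewrite !inE => /andP[xb xc] /andP[yb yc] /card_pencil2 /eqP.
apply/negP; rewrite neq_ltn; apply/orP; right; apply/card_gt1P.
by exists b, c; split=> //; rewrite !inE ?bB ?cB ?xb ?xc ?yb ?yc.
Qed.

(** * Intersections of blocks with a point set *)

Lemma sum_block_meet (A : {set U}) : \sum_(d in B) #|d :&: A| = #|A| * q ^ 2.
Proof.
by rewrite double_count; under eq_bigr do rewrite card_pencil; rewrite sum_nat_const.
Qed.

(** Ordered pairs from [A] are counted by the blocks containing them: q^2 for a diagonal pair, one
    for any other. The summand [#|A|] on the left avoids subtraction. *)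
Lemma sum_block_meet_sq (A : {set U}) :
  \sum_(d in B) #|d :&: A| * #|d :&: A| + #|A| = #|A| * (#|A| + q ^ 2).
Proof.
rewrite weighted_double_count -sum_nat_const -[X in _ + X]sum1_card -big_split /=.
apply: eq_bigr => x xA; rewrite double_count (bigD1 x xA) /=.
rewrite (eq_bigr (fun=> 1)); last first.
  by move=> y /andP[_ nyx]; apply: card_pencil2; rewrite eq_sym.
have -> : pencil (pencil B x) x = pencil B x.
  by apply/setP => b; rewrite !inE -andbA andbb.
rewrite card_pencil sum1_neq.
have := cardsD1 x A; rewrite xA /=; move: #|_ :\ _| => n; lia.
Qed.

Lemma sum_block_meet_setC (A : {set U}) :
  \sum_(d in B) #|d :&: ~: A| * #|d :&: A| = #|~: A| * #|A|.
Proof.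
rewrite weighted_double_count -sum_nat_const; apply: eq_bigr => x.
rewrite inE => xA; rewrite double_count -sum1_card; apply: eq_bigr => y yA.
by apply: card_pencil2; apply: contraNneq xA => ->.
Qed.

(* (q-1) k (k-1) - 2 (q+1-k)(k-1) = (q+1)(k-1)(k-2). *)
Lemma meet_trade_off k j : k + j = q + 1 ->
  2 * (j * k) + (q - 1) * k <= (q - 1) * (k * k) + 2 * j.
Proof.
move=> kj; have -> : j = q + 1 - k by lia.
case: k kj => [|[|k]] kj; [lia|lia|].
have [p qp] : exists p, q = p + k + 1 by exists (q - k - 1); lia.
rewrite qp; nia.
Qed.

(** * Cliques of q^2 blocks without a common point *)

Section Clique.

Variable C : {set {set U}}.
Hypothesis CB : C \subset B.
Hypothesis C_meet : forall b c, b \in C -> c \in C -> b :&: c != set0.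
Hypothesis card_C : #|C| = q ^ 2.
Hypothesis C_nopoint : forall x, exists2 b, b \in C & x \notin b.

Let C_B b : b \in C -> b \in B. Proof. exact: (subsetP CB). Qed.

Let card_meet b c : b \in C -> c \in C -> b != c -> #|b :&: c| = 1.
Proof.
move=> bC cC nbc; apply/eqP; rewrite eqn_leq card_block_meet ?C_B //=.
by rewrite card_gt0 C_meet.
Qed.

(** The block [b] contributes q+1, and each of the other q^2-1 clique blocks meets it in one
    point. *)
Lemma clique_sum_degrees b : b \in C -> \sum_(x in b) #|pencil C x| = q ^ 2 + q.
Proof.
move=> bC; rewrite -double_count (bigD1 b bC) /= setIid (card_block (C_B bC)).
rewrite (eq_bigr (fun=> 1)); last by move=> c /andP[cC ncb]; rewrite card_meet.
rewrite sum1_neq.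
have := cardsD1 b C; rewrite bC card_C /=; move: #|_ :\ _| => n; lia.
Qed.

Lemma clique_degree_sum x b : b \in C -> x \notin b ->
  #|pencil C x| = \sum_(y in b) #|pencil (pencil C x) y|.
Proof.
move=> bC xb; rewrite -double_count -sum1_card; apply: eq_bigr => c.
rewrite inE => /andP[cC xc]; rewrite card_meet //.
by apply: contraNneq xb => <-.
Qed.

Lemma clique_pencil2_le x y : x != y -> #|pencil (pencil C x) y| <= 1.
Proof.
move=> /card_pencil2 <-; apply: subset_leq_card; apply/subsetP => b.
by rewrite !inE => /andP[/andP[/C_B -> ->] ->].
Qed.

(** Clique blocks through [x] meet a clique block missing [x] in distinct points. *)
Lemma clique_degree_le x : #|pencil C x| <= q + 1.
Proof.
have [b bC xb] := C_nopoint x.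
rewrite (clique_degree_sum bC xb) -(card_block (C_B bC)) -sum1_card.
by apply: leq_sum => y yb; apply: clique_pencil2_le; apply: contraNneq xb => ->.
Qed.

Let S := cover C.

Let setI_cover c : c \in C -> c :&: S = c.
Proof. by move=> cC; apply/setIidPl; rewrite /S /cover (bigcup_sup c). Qed.

Lemma card_cover_full x : #|pencil C x| = q + 1 -> #|S| = q ^ 2 + q + 1.
Proof.
move=> full; have xS : x \in S.
  have: 0 < #|pencil C x| by rewrite full addn1.
  case/card_gt0P => b; rewrite inE => /andP[bC xb].
  by apply/bigcupP; exists b.
have deg1 y : y \in S -> y != x -> #|pencil (pencil C x) y| = 1.
  case/bigcupP => b bC yb nyx.
  have [xb|xb] := boolP (x \in b).
    apply/eqP; rewrite eqn_leq clique_pencil2_le 1?eq_sym //=.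
    by apply/card_gt0P; exists b; rewrite !inE bC xb yb.
  apply: (sum_eq_const_bound (f := fun z => #|pencil (pencil C x) z|) _ _ yb).
    by move=> z zb; apply: clique_pencil2_le; apply: contraNneq xb => ->.
  by rewrite -clique_degree_sum // full muln1 card_block ?C_B.
(* Hence the q+1 blocks through [x] already cover [S], so |S| = 1 + (q+1)q. *)
have := double_count (pencil C x) S.
rewrite (eq_bigr (fun=> q + 1)); last first.
  by move=> c; rewrite inE => /andP[cC _]; rewrite setI_cover ?card_block ?C_B.
rewrite sum_nat_const full (bigD1 x xS) /= (eq_bigr (fun=> 1)); last first.
  by move=> y /andP[yS nyx]; apply: deg1.
rewrite sum1_neq.
have -> : pencil (pencil C x) x = pencil C x.
  by apply/setP => b; rewrite !inE -andbA andbb.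
have := cardsD1 x S; rewrite xS full /=; move: #|_ :\ _| => n; nia.
Qed.

(** The mean degree along a clique block is (q^2+q)/(q+1) = q, so the bound is attained on all of
    [S]; then q |S| = q^2 (q+1). *)
Lemma card_cover_regular :
  (forall x, #|pencil C x| <= q) -> #|S| = q ^ 2 + q.
Proof.
move=> deg_le.
have deg x : x \in S -> #|pencil C x| = q.
  case/bigcupP => b bC xb; apply: (sum_eq_const_bound (f := fun z => #|pencil C z|) _ _ xb) => //.
  by rewrite clique_sum_degrees // card_block ?C_B //; lia.
have := double_count C S.
rewrite (eq_bigr (fun=> q + 1)); last first.
  by move=> c cC; rewrite setI_cover ?card_block ?C_B.
rewrite [RHS](eq_bigr (fun=> q)) // !sum_nat_const card_C; nia.
Qed.

Lemma card_cover :
  #|S| = q ^ 2 + q + 1 \/ #|S| = q ^ 2 + q.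
Proof.
have [[x /eqP full]|nofull] := altP (@existsP _ (fun x => #|pencil C x| == q + 1)).
  by left; apply: card_cover_full full.
right; apply: card_cover_regular => x.
move: nofull; rewrite negb_exists => /forallP/(_ x).
have := clique_degree_le x; lia.
Qed.

Lemma clique_nopoint_order : q <= 2.
Proof.
have zeroC d : d \in C -> #|d :&: ~: S| = 0.
  by move=> dC; rewrite -{1}(setI_cover dC) -setIA setICr setI0 cards0.
have kC d : d \in C -> #|d :&: S| = q + 1.
  by move=> dC; rewrite setI_cover // card_block ?C_B.
(* Blocks of [C] lie inside [S] and contribute constants; only sums over the remaining blocks stay
   unknown. *)
have split_sum w : \sum_(d in B) w d = \sum_(d in C) w d + \sum_(d in B :\: C) w d.
  by rewrite (big_setID C) /= (setIidPr CB).
have e1 := sum_block_meet S; have e2 := sum_block_meet_sq S.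
have e3 := sum_block_meet_setC S; have e4 := sum_block_meet (~: S).
move: e1 e2 e3 e4; rewrite !split_sum.
rewrite (eq_bigr (fun=> q + 1)) // sum_nat_const.
rewrite [\sum_(d in C) (_ * #|d :&: S|)](eq_bigr (fun=> (q + 1) * (q + 1))); last first.
  by move=> d dC; rewrite kC.
rewrite [\sum_(d in C) (#|_ :&: ~: S| * _)](eq_bigr (fun=> 0)); last first.
  by move=> d dC; rewrite zeroC.
rewrite [\sum_(d in C) #|_ :&: ~: S|](eq_bigr (fun=> 0)) //.
rewrite !sum_nat_const card_C.
(* [meet_trade_off] summed over the blocks outside the clique, with k and j the numbers of points of
   [d] inside and outside [S]. *)
have : 2 * \sum_(d in B :\: C) #|d :&: ~: S| * #|d :&: S|
       + (q - 1) * \sum_(d in B :\: C) #|d :&: S|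
   <= (q - 1) * \sum_(d in B :\: C) #|d :&: S| * #|d :&: S|
       + 2 * \sum_(d in B :\: C) #|d :&: ~: S|.
  rewrite !big_distrr /= -!big_split /=.
  apply: leq_sum => d; rewrite inE => /andP[_ dB]; apply: meet_trade_off.
  by rewrite -(card_block dB) -(cardsID S d) setDE.
move: (\sum_(d in _) (_ * #|d :&: S|)) => JK.
move: (\sum_(d in _) (_ * _)) => K2.
move: (\sum_(d in _) #|d :&: S|) => K.
move: (\sum_(d in _) _) => J.
have := cardsC S; rewrite card_points muln0 !add0n.
move: #|~: S| => z sz le e1 e2 e3 e4; rewrite leqNgt; apply/negP => q_gt2.
(* Writing q = t + 3 removes truncated subtraction from the polynomials. *)
have [t qt] : exists t, q = t + 3 by exists (q - 3); lia.
have q1 : q - 1 = t + 2 by lia.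
(* After cancelling positive factors, [le] reads 2(q^2-q-1) <= q^2-1 if |S| = q^2+q+1, which fails
   for q > 2, and 2 <= 1 if |S| = q^2+q. *)
case: card_cover sz e1 e2 e3 e4 => -> sz e1 e2 e3 e4.
  have Kq : K = q ^ 4 by lia.
  have K2q : K2 = q ^ 4 + q ^ 3 + 2 * q ^ 2 + q by lia.
  have zt : z = (t + 3) * (t ^ 2 + 5 * t + 5) by rewrite qt in sz; lia.
  by move: le; rewrite e3 e4 Kq K2q zt q1 qt; lia.
have Kq : K = (t + 3) ^ 2 * (t + 2) * (t + 4) by rewrite qt in e1; lia.
have K2q : K2 = (t + 3) * (t + 4) ^ 2 * (t + 2) by rewrite qt in e2; lia.
have zt : z = (t + 2) ^ 2 * (t + 4) by rewrite qt in sz; lia.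
by move: le; rewrite e3 e4 Kq K2q zt q1 qt; lia.
Qed.

End Clique.
End Unital.

(** * Recovering points from their pencils *)

Theorem theorem2p3 (q q' : nat) (U U' : finType)
    (B : {set {set U}}) (B' : {set {set U'}})
    (hU : unital q B) (hU' : unital q' B') (hq : 2 < q)
    (beta : block B -> block B')
    (hbeta : graph_iso (@confluence U B) (@confluence U' B') beta) :
  exists alpha : U -> U', incidence_iso alpha beta.
Proof.
case: hbeta => beta_bij beta_edge; have beta_inj := bij_inj beta_bij.
(* The number of blocks is preserved and strictly increasing in the order. *)
have eqq : q' = q.
  have : #|B| = #|B'|.
    by have := bij_eq_card beta_bij; rewrite !card_sig.
  rewrite (card_blocks hU) (card_blocks hU').
  have lt_blocks m n : m < n -> m ^ 2 * (m * (m - 1) + 1) < n ^ 2 * (n * (n - 1) + 1).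
    move=> mn; have sq_lt : m ^ 2 < n ^ 2 by rewrite ltn_sqr.
    apply: (@leq_trans (n ^ 2 * (m * (m - 1) + 1))); first by rewrite ltn_pmul2r ?addn1.
    by rewrite leq_mul2l leq_add2r leq_mul ?orbT // ?leq_sub2r // ltnW.
  by move=> eBB'; case: (ltngtP q q') => // /lt_blocks; rewrite eBB' ltnn.
move: hU'; rewrite {}eqq {q'} => hU'.
pose P x := [set b : block B | x \in val b].
pose C x := [set val (beta b) | b in P x].
have card_CP x : #|C x| = q ^ 2.
  rewrite card_imset; last exact: inj_comp val_inj beta_inj.
  rewrite -(card_pencil hU x) -(card_imset (P x) val_inj).
  congr #|pred_of_set _|; apply/setP => b; rewrite inE.
  apply/imsetP/andP => [[c]|[bB xb]]; first by rewrite inE => xc ->; rewrite (valP c).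
  by exists (Sub b bB); rewrite ?inE SubK.
(* The image [C x] of a pencil is a clique of q^2 blocks, so its blocks share a point, which is
   chosen as [alpha x]. *)
have [alpha alphaP] : exists alpha : U -> U', forall x, C x \subset pencil B' (alpha x).
  apply: (fin_all_exists (P := fun x y => C x \subset pencil B' y)) => x.
  have CB' : C x \subset B' by apply/subsetP => _ /imsetP[b _ ->]; apply: valP.
  have [/existsP[y Cy]|/existsPn noy] := boolP [exists y, C x \subset pencil B' y].
    by exists y.
  suff: q <= 2 by rewrite leqNgt hq.
  apply: (clique_nopoint_order hU' CB') => //.
    move=> _ _ /imsetP[b bP ->] /imsetP[c cP ->].
    move: bP cP; rewrite !inE => xb xc.
    have [<-|nbc] := eqVneq b c.
      rewrite setIid -card_gt0; case: hU' => _ _ -> //; last exact: valP.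
      by rewrite addn1.
    have /beta_edge /andP[_ /existsP[y yP]] : confluence b c.
      by rewrite /confluence nbc; apply/existsP; exists x; rewrite xb xc.
    by apply/set0Pn; exists y; rewrite inE.
  move=> y; have /subsetPn[b bC] := noy y; rewrite inE (subsetP CB' _ bC) /=.
  by exists b.
(* Both sides have q^2 blocks, so the inclusion is an equality. *)
have CE x : C x = pencil B' (alpha x).
  by apply/eqP; rewrite eqEcard alphaP /= card_CP (card_pencil hU') leqnn.
have inc x (b : block B) : (x \in val b) = (alpha x \in val (beta b)).
  transitivity (val (beta b) \in C x); last by rewrite CE inE (valP (beta b)).
  by rewrite [RHS](mem_imset (P x) b (inj_comp val_inj beta_inj)) inE.
(* If [alpha] identifies two points, [inc] gives them the same pencil. *)
have alpha_inj : injective alpha.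
  move=> x y exy; apply: (pencil_inj hU); apply/setP => b; rewrite !inE.
  by case bB: (b \in B) => //=; have := inc x (Sub b bB); rewrite exy -inc !SubK.
exists alpha; split=> //; last by move=> x b; rewrite inc.
apply: inj_card_bij => //.
by case: hU hU' => _ -> _ _ [_ -> _ _].
Qed.
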